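(* Let $n\ge2$ be an integer, $0<\mu\le L_{\max}$, $\epsilon\in(0,1)$. For $q\in[0,1]$ and $\tau\in\{1,\dots,n\}$ let $\Omega^{q,\tau}=\max\{g_1,g_2\}\log(1/\epsilon)$ be the total complexity defined in the context, and let $q_-,q_{i1},q_{i2}$ (functions of $\tau$) be as in the context. Then for each $\tau\in\{1,\dots,n\}$ the minimum of $q\mapsto\Omega^{q,\tau}$ over $[0,1]$ is attained at some $$q^*\in\{1,\ q_-,\ q_{i1},\ q_{i2}\},$$ where only those candidates that are defined for this $\tau$ (as specified in the context) are considered. Consequently, if $$\tau^*\in\arg\min_{\tau\in\{1,\dots,n\}}\ \min\left\{\Omega^{1,\tau},\Omega^{q_-,\tau},\Omega^{q_{i1},\tau},\Omega^{q_{i2},\tau}\right\}$$ and $q^*$ is a candidate attaining the minimum of $\left\{\Omega^{1,\tau^*},\Omega^{q_-,\tau^*},\Omega^{q_{i1},\tau^*},\Omega^{q_{i2},\tau^*}\right\}$, then $(q^*,\tau^* )$ minimizes $\Omega^{q,\tau}$ over all $q\in[0,1]$, $\tau\in\{1,\dots,n\}$.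
   Context: Put $\theta=\frac{n}{q(\tau-1)+1}$, $$\mathcal{L}_1=\frac{L_{\max}}{(q(\tau-1)+1)^2}\left(q\left(\frac{\tau(n-\tau)}{n-1}-1\right)+1+nq\,\frac{\tau(\tau-1)}{n-1}\right)=\frac{q(\tau^2-1)+1}{(q(\tau-1)+1)^2}L_{\max},$$ $$\rho=\begin{cases}\theta^2\left(\frac{1-q}{n}+q\frac{\tau}{n}\frac{n-\tau}{n-1}\right), & q\theta^2\le\frac{n}{\tau}\frac{n-1}{\tau-1},\\[4pt] \theta^2\left(\frac{1-q}{n}+q\frac{\tau}{n}\frac{n-\tau}{n-1}\right)+n\left(\theta^2q\frac{\tau}{n}\frac{\tau-1}{n-1}-1\right), & q\theta^2\ge\frac{n}{\tau}\frac{n-1}{\tau-1}\end{cases}$$ (for $\tau=1$ the threshold is $+\infty$ and the first case applies), $$g_1=\frac{4\mathcal{L}_1}{\mu}\left(q(\tau-1)+1\right),\qquad g_2=\left(\theta+\frac{4\rho L_{\max}}{\mu n}\right)\left(q(\tau-1)+1\right).$$ (These come from the convergence analysis of a SAGA/minibatch-SAGA method for a $\mu$-strongly convex $f=\frac1n\sum f_i$ with all smoothness constants estimated by $L_i=L_{\max}$; necessarily $\mu\le L_{\max}$.) Candidates: - $q_-=\frac{n\tau+2(1-n)-\sqrt{n\tau}\sqrt{4(1-n)+n\tau}}{2(n-1)(\tau-1)}$, defined when $\tau\ge2$ and $n\tau\ge4(n-1)$ (i.e. when it is real). - $q_{i1}=\frac{n-1}{(\tau-1)\left(\tau\frac{4L_{\max}}{\mu}+1-n\right)}$,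 defined for $\tau\in[\tau_{\min},\tau_{\max}]$. - $q_{i2}=\frac{n-\frac{4L_{\max}}{\mu}}{\frac{4L_{\max}}{\mu}(\tau-1)}$, defined for $\tau\in(\tau_{\max},n]$. Here $\tau_{\min}=\frac{n\mu}{4L_{\max}}+1-\frac{\mu}{4L_{\max}}$, and $\tau_{\max}=\min\left(\frac{n(n-1)\mu}{\left(n-\frac{4L_{\max}}{\mu}\right)4L_{\max}},\,n\right)$ if $n>\frac{4L_{\max}}{\mu}$, $\tau_{\max}=n$ if $n\le\frac{4L_{\max}}{\mu}$. *)

(* Defs.v *)
From HB Require Import structures.
From mathcomp Require Import all_boot all_order all_algebra.
From mathcomp Require Import mathcomp_extra boolp classical_sets set_interval.
From mathcomp Require Import reals exp.
From mathcomp Require Import ring.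

Set Implicit Arguments.
Unset Strict Implicit.
Unset Printing Implicit Defensive.

Import Order.TTheory GRing.Theory Num.Theory.
Local Open Scope classical_set_scope.
Local Open Scope ring_scope.

(* x belongs to argmin_A f. *)
Definition minimizes (R : realType) (T : Type) (A : set T) (f : T -> R)
    (x : T) : Prop :=
  A x /\ forall y, A y -> f x <= f y.

(* Expected size of a random minibatch that has tau elements with probability
   q and a single element with probability 1 - q. *)
Definition exp_size (R : realType) (q : R) (tau : nat) : R :=
  q * (tau%:R - 1) + 1.

Definition theta (R : realType) (n : nat) (q : R) (tau : nat) : R :=
  n%:R / exp_size q tau.

Definition calL1 (R : realType) (n : nat) (L q : R) (tau : nat) : R :=
  let N : R := n%:R in let t : R := tau%:R in
  L / exp_size q tau ^+ 2 *
  (q * (t * (N - t) / (N - 1) - 1) + 1 + N * q * (t * (t - 1) / (N - 1))).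

Lemma calL1E (R : realType) (n : nat) (L q : R) (tau : nat) : (1 < n)%N ->
  calL1 n L q tau = (q * (tau%:R ^+ 2 - 1) + 1) / exp_size q tau ^+ 2 * L.
Proof.
move=> n1; have n10 : n%:R - 1 != 0 :> R by rewrite subr_eq0 pnatr_eq1 gtn_eqF.
rewrite /calL1 -[RHS]mulrA [RHS]mulrC (mulrC L).
rewrite [in RHS](mulrC _ L) (mulrC _ L); congr (_ * _).
by field.
Qed.

(* The two cases of the definition overlap at equality, where they agree.
   For tau = 1 the threshold is +oo, whereas the formula would divide by 0,
   hence the explicit test. *)
Definition rho (R : realType) (n : nat) (q : R) (tau : nat) : R :=
  let N : R := n%:R in let t : R := tau%:R in let th := theta n q tau in
  let base :=
    th ^+ 2 * ((1 - q) / N + q * (t / N) * ((N - t) / (N - 1))) in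
  if (tau == 1%N) || (q * th ^+ 2 <= N / t * ((N - 1) / (t - 1))) then base
  else base + N * (th ^+ 2 * q * (t / N) * ((t - 1) / (N - 1)) - 1).

Definition g1 (R : realType) (n : nat) (mu L q : R) (tau : nat) : R :=
  4 * calL1 n L q tau / mu * exp_size q tau.

Definition g2 (R : realType) (n : nat) (mu L q : R) (tau : nat) : R :=
  (theta n q tau + 4 * rho n q tau * L / (mu * n%:R)) * exp_size q tau.

Definition Omega (R : realType) (n : nat) (mu L eps q : R) (tau : nat) : R :=
  Num.max (g1 n mu L q tau) (g2 n mu L q tau) * ln (1 / eps).

Definition q_minus (R : realType) (n tau : nat) : R :=
  let N : R := n%:R in let t : R := tau%:R in
  (N * t + 2 * (1 - N) - Num.sqrt (N * t) * Num.sqrt (4 * (1 - N) + N * t))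
  / (2 * (N - 1) * (t - 1)).

Definition q_i1 (R : realType) (n : nat) (mu L : R) (tau : nat) : R :=
  (n%:R - 1) / ((tau%:R - 1) * (tau%:R * (4 * L / mu) + 1 - n%:R)).

Definition q_i2 (R : realType) (n : nat) (mu L : R) (tau : nat) : R :=
  (n%:R - 4 * L / mu) / (4 * L / mu * (tau%:R - 1)).

Definition tau_min (R : realType) (n : nat) (mu L : R) : R :=
  n%:R * mu / (4 * L) + 1 - mu / (4 * L).

Definition tau_max (R : realType) (n : nat) (mu L : R) : R :=
  if 4 * L / mu < n%:R then
    Num.min (n%:R * (n%:R - 1) * mu / ((n%:R - 4 * L / mu) * (4 * L))) n%:R
  else n%:R.

(* The candidates that are defined for tau; 1 always is. *)
Definition candidates (R : realType) (n : nat) (mu L : R) (tau : nat) : seq R :=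
  let N : R := n%:R in let t : R := tau%:R in
  [:: 1 : R]
  ++ (if (2 <= tau)%N && (4 * (N - 1) <= N * t)
      then [:: q_minus R n tau] else [::])
  ++ (if tau_min n mu L <= t <= tau_max n mu L
      then [:: q_i1 n mu L tau] else [::])
  ++ (if tau_max n mu L < t <= N
      then [:: q_i2 n mu L tau] else [::]).

(* Minimum of Omega over the candidates; since 1 is always a candidate, taking
   its value as the default element of the iterated minimum is harmless. *)
Definition candidate_min (R : realType) (n : nat) (mu L eps : R) (tau : nat)
    : R :=
  \big[Num.min/Omega n mu L eps 1 tau]_(q <- candidates n mu L tau)
    Omega n mu L eps q tau.

(* Main.v *)
Require Import Defs.
From HB Require Import structures.
From mathcomp Require Import all_boot all_order all_algebra.
From mathcomp Require Import mathcomp_extra boolp classical_sets set_interval.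
From mathcomp Require Import reals exp.
From mathcomp Require Import ring lra.

Set Implicit Arguments.
Unset Strict Implicit.
Unset Printing Implicit Defensive.

Import Order.TTheory GRing.Theory Num.Theory.
Local Open Scope classical_set_scope.
Local Open Scope ring_scope.

(* For tau >= 2 pass to the variable s = q (tau - 1) + 1 in [1, tau] and write
   N = n, t = tau, K = 4 L / mu.  Then g1 = K (t + 1 - t / s) increases with s,
   while g2 = max (A, B), where
     A = N + K ((N - t - 1) / (N - 1) + t / ((N - 1) s))
   decreases with s and B = g1 + N - K s; moreover B >= A exactly when
   p(s) = (N - 1) s^2 - N t s + N t <= 0.  The candidates q_-, q_i1 and q_i2
   correspond to the smaller root of p, to the solution of g1 = A and to the
   solution s = N / K of g1 = B.
   If tau_min <= tau <= tau_max, then B <= A = g1 at the solution of g1 = A,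
   which is therefore optimal.  If tau < tau_min and tau <= tau_max, then
   g1 <= A on [1, t] and B <= A at t, so that q = 1 is optimal.  If
   tau > tau_max, then A <= B = g1 at N / K: on the right g1 is larger; on the
   left the maximum is g2, and either A decreases down to the smaller root of
   p or B, being unimodal, is at least its value at one of the two ends. *)

(** * Minimizing the maximum of [g1], [A] and [B] over [s] *)

Section Reduced.
Variables (R : realFieldType) (N t K : R).
Hypotheses (N1 : 1 < N) (t1 : 1 < t) (tN : t <= N) (K0 : 0 < K).

Definition red_g1 (s : R) : R := K * (t + 1 - t / s).
Definition red_A (s : R) : R :=
  N + K * ((N - t - 1) / (N - 1) + t / (N - 1) / s).
Definition red_B (s : R) : R := red_g1 s + N - K * s.
Definition red_quad (s : R) : R := (N - 1) * s ^+ 2 - N * t * s + N * t.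
Definition red_max (s : R) : R :=
  Num.max (red_g1 s) (Num.max (red_A s) (red_B s)).

Let t0 : 0 < t. Proof. by move: t1; lra. Qed.
Let N10 : 0 < N - 1. Proof. by move: N1; lra. Qed.
Let NK0 := lt0r_neq0 K0.
Let Nt0 := lt0r_neq0 t0.
Let NN10 := lt0r_neq0 N10.

Lemma red_g1_le s s' : 0 < s -> s <= s' -> red_g1 s <= red_g1 s'.
Proof.
move=> s0 ss'; rewrite /red_g1 ler_pM2l // lerD2l lerN2 ler_pM2l //.
by rewrite lef_pV2 ?posrE //; lra.
Qed.

Lemma red_A_ge s s' : 0 < s -> s <= s' -> red_A s' <= red_A s.
Proof.
move=> s0 ss'; rewrite /red_A lerD2l ler_pM2l // lerD2l ler_pM2l ?divr_gt0 //.
by rewrite lef_pV2 ?posrE //; lra.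
Qed.

Lemma red_AsubB s : s != 0 -> red_A s - red_B s = K / (N - 1) / s * red_quad s.
Proof.
move=> s0; rewrite /red_A /red_B /red_g1 /red_quad.
by field; rewrite s0 NN10.
Qed.

Lemma red_B_le_A s : 0 < s -> (red_B s <= red_A s) = (0 <= red_quad s).
Proof.
move=> s0; rewrite -subr_ge0 red_AsubB ?lt0r_neq0 // pmulr_rge0 //.
by rewrite !divr_gt0.
Qed.

Lemma red_A_le_B s : 0 < s -> (red_A s <= red_B s) = (red_quad s <= 0).
Proof.
move=> s0; rewrite -subr_le0 red_AsubB ?lt0r_neq0 // pmulr_rle0 //.
by rewrite !divr_gt0.
Qed.

Lemma red_BsubB s s' : s != 0 -> s' != 0 ->
  red_B s - red_B s' = K * (s' - s) * (1 - t / (s * s')).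
Proof. by move=> s0 s'0; rewrite /red_B /red_g1; field; rewrite s'0. Qed.

(** [red_B] increases up to the square root of [t] and decreases afterwards. Comparing [s * b] with
    [t] decides which end to use and avoids the root itself. *)
Lemma red_B_unimodal a s b : 0 < a -> a <= s -> s <= b ->
  (red_B a <= red_B s) || (red_B b <= red_B s).
Proof.
move=> a0 as_ sb; have s0 : 0 < s by lra.
have b0 : 0 < b by lra.
have [tle|tgt] := leP t (s * b); apply/orP; [right|left];
  rewrite -subr_ge0 red_BsubB ?lt0r_neq0 //.
  rewrite mulr_ge0 ?(mulr_ge0 (ltW K0)) ?subr_ge0 //.
  by rewrite ler_pdivrMr ?mul1r // mulr_gt0.
rewrite -mulrA mulr_ge0 ?(ltW K0) // mulr_le0 ?subr_le0 //.
rewrite ler_pdivlMr ?mul1r ?mulr_gt0 //; apply: le_trans (ltW tgt).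
by rewrite ler_wpM2l //; lra.
Qed.

Lemma red_g1subA s : s != 0 ->
  red_g1 s - red_A s = N / (N - 1) / s * ((K * t - (N - 1)) * s - K * t).
Proof. by move=> s0; rewrite /red_A /red_g1; field; rewrite s0 NN10. Qed.

(** The equation on [s] says [g1 = A] there. Multiplied by [K * t - (N - 1) > 0], the bound
    [N <= K * s], that is [B <= g1] at [s], becomes the last hypothesis. *)
Lemma red_max_min_g1A s s' : 0 < s -> 0 < s' ->
  (K * t - (N - 1)) * s = K * t -> K * t * (N - K) <= N * (N - 1) ->
  red_max s <= red_max s'.
Proof.
move=> s0 s'0 sE le_t.
have eqA : red_A s = red_g1 s.
  by apply/esym/eqP; rewrite -subr_eq0 red_g1subA ?lt0r_neq0 // sE subrr mulr0.
have leB : red_B s <= red_g1 s.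
  rewrite /red_B -addrA gerDl subr_le0.
  have D0 : 0 < K * t - (N - 1) by rewrite -(pmulr_lgt0 _ s0) sE mulr_gt0.
  by rewrite -(ler_pM2l D0) mulrCA sE; lra.
have -> : red_max s = red_g1 s.
  by rewrite /red_max eqA (max_idPl leB) maxxx.
rewrite /red_max !le_max; have [ss'|/ltW s's] := leP s s'.
  by rewrite red_g1_le.
by rewrite -eqA red_A_ge ?orbT.
Qed.

(** At the right end [p(t) = t * (N - t) >= 0], so [B <= A], and the bound on [K] amounts to
    [g1 <= A]. The maximum at [t] is thus the least value of the decreasing [A]. *)
Lemma red_max_min_right s : 1 <= s -> s <= t -> K * (t - 1) <= N - 1 ->
  red_max t <= red_max s.
Proof.
move=> s1 st le_min; have s0 : 0 < s by lra.
have leB : red_B t <= red_A t.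
  by rewrite red_B_le_A // /red_quad; move: t1 tN; nra.
have leg1 : red_g1 t <= red_A t.
  rewrite -subr_le0 red_g1subA // pmulr_rle0 ?divr_gt0 //;
    last by move: N1; lra.
  by move: K0 N1; nra.
have -> : red_max t = red_A t.
  by rewrite /red_max (max_idPl leB) (max_idPr leg1).
by rewrite /red_max !le_max red_A_ge ?orbT.
Qed.

Lemma red_max_min_g1B sm s : 0 < s -> 0 < sm -> sm <= N / K ->
  red_quad sm = 0 -> red_quad (N / K) <= 0 ->
  (red_max sm <= red_max s) || (red_max (N / K) <= red_max s).
Proof.
move=> s0 sm0 sm_le pm p2.
have s20 : 0 < N / K by rewrite divr_gt0 //; move: N1; lra.
have B2 : red_B (N / K) = red_g1 (N / K) by rewrite /red_B; field.
have max2 : red_max (N / K) = red_g1 (N / K).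
  have A2 : red_A (N / K) <= red_g1 (N / K) by rewrite -B2 red_A_le_B.
  by rewrite /red_max B2 (max_idPr A2) maxxx.
have ABm : red_A sm = red_B sm.
  by apply/eqP; rewrite -subr_eq0 red_AsubB ?lt0r_neq0 // pm mulr0.
have maxm : red_max sm = red_B sm.
  rewrite /red_max ABm maxxx; apply/max_idPr.
  (* [B - g1 = N - K * s] is nonnegative to the left of [N / K]. *)
  rewrite /red_B -addrA lerDl subr_ge0.
  by rewrite mulrC -ler_pdivlMr.
rewrite max2 maxm; have [s2s|/ltW ss2] := leP (N / K) s.
  by apply/orP; right; rewrite /red_max !le_max red_g1_le.
have [sms|/ltW ssm] := leP sm s.
  have := red_B_unimodal sm0 sms ss2; rewrite B2.
  by case/orP=> h; apply/orP; [left|right]; rewrite /red_max !le_max h !orbT.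
by apply/orP; left; rewrite /red_max !le_max -ABm red_A_ge ?orbT.
Qed.

End Reduced.

(** * The thresholds for [tau], and the case [tau = 1] *)

Section Candidates.
Variables (R : realType) (n tau : nat) (mu L eps : R).
Hypotheses (n2 : (2 <= n)%N) (mu0 : 0 < mu) (muL : mu <= L).

Let N : R := n%:R.
Let t : R := tau%:R.
Let K : R := 4 * L / mu.
Let N1 : 1 < N. Proof. by rewrite /N ltr1n. Qed.
Let N0 : 0 < N. Proof. exact: lt_trans N1. Qed.
Let L0 : 0 < L. Proof. exact: lt_le_trans muL. Qed.
Let NL0 : L != 0. Proof. exact: lt0r_neq0. Qed.
Let K1 : 1 <= K.
Proof. by rewrite ler_pdivlMr // mul1r; move: mu0 muL; lra. Qed.
Let K0 : 0 < K. Proof. exact: lt_le_trans K1. Qed.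
Let NN0 : N != 0. Proof. exact: lt0r_neq0. Qed.
Let NK0 : K != 0. Proof. exact: lt0r_neq0. Qed.
Let NN10 : N - 1 != 0. Proof. by rewrite subr_eq0 gt_eqF. Qed.
Let Nmu0 : mu != 0. Proof. exact: lt0r_neq0. Qed.

Lemma tau_min_le : (tau_min n mu L <= t) = (N - 1 <= K * (t - 1)).
Proof.
have -> : tau_min n mu L = (N - 1) / K + 1.
  by rewrite /tau_min -/N /K; field; rewrite NL0 Nmu0.
by rewrite -lerBrDr ler_pdivrMr // mulrC.
Qed.

(** Clearing denominators merges both branches of [tau_max]: if [N <= K], the left-hand side is
    nonpositive and the inequality is automatic, as is [t <= N]. *)
Lemma le_tau_max : (tau <= n)%N ->
  (t <= tau_max n mu L) = (K * t * (N - K) <= N * (N - 1)).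
Proof.
move=> le_tn; have tN : t <= N by rewrite /t /N ler_nat.
rewrite /tau_max -/N -/K; case: ifPn => [KN|]; last first.
  rewrite -leNgt => NK; rewrite tN; apply/esym.
  apply: (@le_trans _ _ 0).
    by rewrite mulr_ge0_le0 ?subr_le0 // mulr_ge0 ?ler0n // ltW.
  by rewrite mulr_ge0 ?subr_ge0 // ltW.
have NK10 : 0 < N - K by rewrite subr_gt0.
have -> : N * (N - 1) * mu / ((N - K) * (4 * L)) = N * (N - 1) / ((N - K) * K).
  have -> : 4 * L = K * mu by rewrite /K divfK.
  by field; rewrite Nmu0 NK0 lt0r_neq0.
rewrite le_min tN andbT ler_pdivlMr; last exact: mulr_gt0.
by congr (_ <= _); ring.
Qed.

(** The other candidates would divide by [tau - 1 = 0]; here [tau_min > 1] and [tau_max >= 1] rule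
    out [q_i1] and [q_i2]. *)
Lemma candidates1 : tau = 1%N -> candidates n mu L tau = [:: 1].
Proof.
move=> tau1; have t1 : t = 1 by rewrite /t tau1.
have le1n : (tau <= n)%N by rewrite tau1 ltnW.
rewrite /candidates -/t tau_min_le ltNge le_tau_max // t1 tau1 /=.
have -> : K * 1 * (N - K) <= N * (N - 1).
  (* Four times the difference of the sides is [(2 * N - 1 - K)^2 + (K - 1) * (3 * K + 1)], and
     [K >= 1]. *)
  by have := sqr_ge0 (2 * N - (1 + K)); move: K1; nra.
by rewrite leNgt subrr mulr0 subr_gt0 N1.
Qed.

Lemma Omega1 (q q' : R) : tau = 1%N ->
  Omega n mu L eps q tau = Omega n mu L eps q' tau.
Proof.
move=> tau1; rewrite /Omega /g1 /g2 /rho /calL1 /theta /exp_size tau1 eqxx /=.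
rewrite !(subrr, mulr0, add0r, mulr1, mul1r, mul0r, divff NN10) -/N.
by rewrite -!mulrDl !subrK.
Qed.

(** * Passage from [q] to [s] for [tau >= 2] *)

Section LargeTau.
Hypothesis t2 : (2 <= tau)%N.
Let t1 : 1 < t. Proof. by rewrite /t ltr1n. Qed.
Let t0 : 0 < t. Proof. exact: lt_trans t1. Qed.
Let Nt0 : t != 0. Proof. exact: lt0r_neq0. Qed.
Let t10 : 0 < t - 1. Proof. by rewrite subr_gt0. Qed.
Let Nt10 : t - 1 != 0. Proof. exact: lt0r_neq0. Qed.

Lemma exp_size_itv (q : R) :
  (0 <= q <= 1) = (1 <= exp_size q tau <= t).
Proof.
rewrite /exp_size -/t lerDr pmulr_lge0 //; congr andb.
by rewrite -lerBrDr ger_pMl.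
Qed.

Section Values.
Variable q : R.
Hypothesis q0 : 0 <= q.
Let s := exp_size q tau.
Let s0 : 0 < s.
Proof. by rewrite /s /exp_size -/t ltr_wpDl // mulr_ge0 // ltW. Qed.
Let Ns0 : s != 0. Proof. exact: lt0r_neq0. Qed.

Lemma g1_red : g1 n mu L q tau = red_g1 t K s.
Proof.
move: Ns0; rewrite /g1 calL1E // /red_g1 /K /s /exp_size -/t => h.
by field; rewrite h.
Qed.

Lemma rho_threshold :
  (q * theta n q tau ^+ 2 <= N / t * ((N - 1) / (t - 1))) =
  (0 <= red_quad N t s).
Proof.
have E : N / t * ((N - 1) / (t - 1)) - q * theta n q tau ^+ 2
    = N / (t * (t - 1) * s ^+ 2) * red_quad N t s.
  move: Ns0; rewrite /theta /red_quad /s /exp_size -/t -/N => h.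
  by field; rewrite h Nt0 Nt10.
rewrite -subr_ge0 E pmulr_rge0 // divr_gt0 // mulr_gt0 ?exprn_gt0 //.
by rewrite mulr_gt0.
Qed.

(** The sign of [p] selects the branch of [rho] and also the larger of [A] and [B], so the case
    distinction turns into a maximum. *)
Lemma g2_red : g2 n mu L q tau = Num.max (red_A N t K s) (red_B N t K s).
Proof.
rewrite /g2 /rho gtn_eqF //= -/N -/t rho_threshold.
case: ifP => [p0|/negbT]; last rewrite -ltNge => /ltW p0.
  rewrite (max_idPl _); last by rewrite red_B_le_A.
  move: Ns0; rewrite /theta /red_A /K /s /exp_size -/t -/N => h.
  by field; rewrite h NN0 NN10 Nmu0.
rewrite (max_idPr _); last by rewrite red_A_le_B.
move: Ns0; rewrite /theta /red_B /red_g1 /K /s /exp_size -/t -/N => h.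
by field; rewrite h NN0 NN10 Nmu0.
Qed.

Lemma Omega_red : Omega n mu L eps q tau = red_max N t K s * ln (1 / eps).
Proof. by rewrite /Omega g1_red g2_red. Qed.
End Values.

(** * Positions of the candidates in the variable [s] *)

Lemma exp_size_q_i1 : K * t - (N - 1) != 0 ->
  exp_size (q_i1 n mu L tau) tau = K * t / (K * t - (N - 1)).
Proof.
move=> D0; rewrite /q_i1 /exp_size -/t -/N -/K.
by field; rewrite D0 Nt10.
Qed.

Lemma exp_size_q_i2 : exp_size (q_i2 n mu L tau) tau = N / K.
Proof.
by rewrite /q_i2 /exp_size -/t -/N -/K; field; rewrite NK0 Nt10.
Qed.

Lemma exp_size_q_minus : exp_size (q_minus R n tau) tau =
  (N * t - Num.sqrt (N * t) * Num.sqrt (4 * (1 - N) + N * t)) / (2 * (N - 1)).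
Proof.
rewrite /q_minus /exp_size -/t -/N.
by field; rewrite NN10 Nt10.
Qed.

(** Completing the square in [p]; the last summand is its discriminant. *)
Lemma quad_square (s : R) : (2 * (N - 1) * s - N * t) ^+ 2 =
  4 * (N - 1) * red_quad N t s + N * t * (4 * (1 - N) + N * t).
Proof. by rewrite /red_quad; ring. Qed.

(** A convex quadratic that is nonpositive somewhere has a nonnegative discriminant; dividing by
    [N * t] leaves the condition for [q_minus] to be real. *)
Lemma q_minus_def (s : R) : red_quad N t s <= 0 -> 4 * (N - 1) <= N * t.
Proof.
move=> p0; have Nt_gt0 : 0 < N * t by rewrite mulr_gt0.
rewrite -subr_ge0 -(pmulr_rge0 _ Nt_gt0) -opprB.
have := sqr_ge0 (2 * (N - 1) * s - N * t); rewrite quad_square.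
have : 4 * (N - 1) * red_quad N t s <= 0.
  by rewrite mulr_ge0_le0 // mulr_ge0 ?ler0n // subr_ge0 ltW.
by rewrite !opprB; lra.
Qed.

Section QMinus.
Hypothesis q_minus_real : 4 * (N - 1) <= N * t.
Let r := Num.sqrt (N * t) * Num.sqrt (4 * (1 - N) + N * t).
Let r0 : 0 <= r. Proof. by rewrite mulr_ge0 ?sqrtr_ge0. Qed.
Let r2 : r ^+ 2 = N * t * (4 * (1 - N) + N * t).
Proof.
rewrite exprMn sqr_sqrtr; last by rewrite mulr_ge0 // ltW.
rewrite sqr_sqrtr //; by move: q_minus_real; lra.
Qed.
Let sm := exp_size (q_minus R n tau) tau.
Let smE : sm = (N * t - r) / (2 * (N - 1)).
Proof. exact: exp_size_q_minus. Qed.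
Let smM : 2 * (N - 1) * sm = N * t - r.
Proof. by rewrite smE; field. Qed.
Let D0 : 0 < 2 * (N - 1). Proof. by rewrite mulr_gt0 // subr_gt0. Qed.

Lemma red_quad_q_minus : red_quad N t sm = 0.
Proof.
have := quad_square sm; rewrite -r2 smM => /eqP.
rewrite addrAC subrr sub0r sqrrN -subr_eq0 opprD addrCA subrr addr0 oppr_eq0.
by rewrite !mulf_eq0 (negbTE NN10) pnatr_eq0 /= => /eqP.
Qed.

Lemma exp_size_q_minus_itv : 1 <= sm <= t.
Proof.
rewrite smE ler_pdivlMr // ler_pdivrMr // mul1r lerBrDr -lerBrDl.
apply/andP; split.
  (* The claim is [r <= N * t - 2 * (N - 1)]; the squares differ by [4 * (N - 1)^2]. *)
  rewrite -ler_sqr ?nnegrE //; last by move: q_minus_real N1; lra.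
  by rewrite r2; have := sqr_ge0 (N - 1); lra.
(* [N <= 2 * (N - 1)], so the upper bound holds even with [r] dropped. *)
have N2 : 2 <= N by rewrite /N ler_nat.
by move: r0 t0; nra.
Qed.

(** Where [p(s) <= 0], the distance from [2 * (N - 1) * s] to [N * t] is at most [r]; hence [sm] is
    the smaller root. *)
Lemma exp_size_q_minus_le (s : R) : red_quad N t s <= 0 -> sm <= s.
Proof.
move=> p0; rewrite smE ler_pdivrMr // (mulrC s) lerBlDr -lerBlDl.
apply: (le_trans (ler_norm _)); rewrite distrC -(ger0_norm r0).
rewrite -ler_sqr ?nnegrE // !real_normK ?num_real // quad_square r2 gerDr.
by rewrite mulr_ge0_le0 // mulr_ge0 ?ler0n // subr_ge0 ltW.
Qed.
End QMinus.

Hypothesis le_tn : (tau <= n)%N.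
Let tN : t <= N. Proof. by rewrite /t /N ler_nat. Qed.

Lemma exp_size_q_i1_itv : N - 1 <= K * (t - 1) ->
  1 <= exp_size (q_i1 n mu L tau) tau <= t.
Proof.
move=> le_min; have D0 : 0 < K * t - (N - 1) by move: K0; lra.
rewrite exp_size_q_i1 ?lt0r_neq0 // ler_pdivlMr // ler_pdivrMr // mul1r.
by rewrite gerBl subr_ge0 (ltW N1) /=; move: t0; nra.
Qed.

(** The hypothesis, which is [tau > tau_max], forces [K < N]. Then [N <= K * t] follows from
    [N * (N - K) <= N * (N - 1)], as [K >= 1], and [p(N / K)] is a positive multiple of the
    difference of the two sides. *)
Lemma gt_tau_max_quad : N * (N - 1) < K * t * (N - K) ->
  1 <= N / K <= t /\ red_quad N t (N / K) <= 0.
Proof.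
move=> gt_max.
have KN : 0 < N - K.
  rewrite -(pmulr_rgt0 _ (mulr_gt0 K0 t0)); apply: le_lt_trans gt_max.
  by rewrite mulr_ge0 ?subr_ge0 // ltW.
split.
  rewrite ler_pdivlMr // ler_pdivrMr // mul1r -subr_ge0 (ltW KN) /=.
  rewrite -(ler_pM2r KN) mulrC (mulrC t); apply: le_trans (ltW gt_max).
  by rewrite mulrC ler_pM2l // lerD2l lerN2.
have -> : red_quad N t (N / K) = N / K ^+ 2 * (N * (N - 1) - K * t * (N - K)).
  by rewrite /red_quad; field.
by rewrite mulr_ge0_le0 ?divr_ge0 ?exprn_ge0 ?subr_le0 // ltW.
Qed.

End LargeTau.

(** * Optimality of the candidates and their minimum *)

Lemma mem_candidates (q : R) : (q \in candidates n mu L tau) =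
  [|| q == 1,
      [&& (2 <= tau)%N, 4 * (N - 1) <= N * t & q == q_minus R n tau],
      (tau_min n mu L <= t <= tau_max n mu L) && (q == q_i1 n mu L tau) |
      (tau_max n mu L < t <= N) && (q == q_i2 n mu L tau)].
Proof.
rewrite /candidates !mem_cat inE andbA -/N -/t.
by do 3![case: ifP => _ //=]; rewrite ?inE ?in_nil ?orbF.
Qed.

Hypothesis tau_itv : (1 <= tau <= n)%N.
Let le_tn : (tau <= n)%N. Proof. by case/andP: tau_itv. Qed.
Let tau1Vge2 : tau = 1%N \/ (2 <= tau)%N.
Proof.
by case/andP: tau_itv; rewrite leq_eqVlt => /orP[/eqP<-|]; [left|right].
Qed.

Lemma candidates_itv (q : R) : q \in candidates n mu L tau -> 0 <= q <= 1.
Proof.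
have [tau1|t2] := tau1Vge2.
  by rewrite candidates1 // inE => /eqP ->; rewrite ler01 lexx.
rewrite mem_candidates => /or4P[/eqP->|/and3P[_ re /eqP->]|
  /andP[+ /eqP->]|/andP[+ /eqP->]].
- by rewrite ler01 lexx.
- by rewrite exp_size_itv // exp_size_q_minus_itv.
- rewrite tau_min_le => /andP[? _].
  by rewrite exp_size_itv // exp_size_q_i1_itv.
- rewrite ltNge le_tau_max // -ltNge => /andP[gt_max _].
  by rewrite exp_size_itv // exp_size_q_i2 //;
    case: (gt_tau_max_quad t2 gt_max).
Qed.

Hypotheses (eps0 : 0 < eps) (eps1 : eps < 1).
Let ln_ge0 : 0 <= ln (1 / eps).
Proof. by rewrite ln_ge0 // ler_pdivlMr // mul1r ltW. Qed.

Lemma candidate_le (q : R) : 0 <= q <= 1 ->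
  exists2 q', q' \in candidates n mu L tau &
    Omega n mu L eps q' tau <= Omega n mu L eps q tau.
Proof.
have [tau1|t2] := tau1Vge2 => [_|q01].
  by exists 1; rewrite ?candidates1 ?mem_head // (Omega1 1 q).
have t1 : 1 < t by rewrite /t ltr1n.
have tN : t <= N by rewrite /t /N ler_nat.
pose s := exp_size q tau.
have /andP[s1 st] : 1 <= s <= t by rewrite -exp_size_itv.
have s0 : 0 < s by exact: lt_le_trans s1.
(* The logarithm is nonnegative, so only the maxima in [s] matter. *)
suff [q' q'c le_q'] : exists2 q', q' \in candidates n mu L tau &
    red_max N t K (exp_size q' tau) <= red_max N t K s.
  exists q' => //; have /andP[q'0 _] := candidates_itv q'c.
  have /andP[q0 _] := q01.
  by rewrite !Omega_red // ler_wpM2r.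
have [le_max|] := boolP (t <= tau_max n mu L).
  have [le_min|] := boolP (tau_min n mu L <= t).
    exists (q_i1 n mu L tau).
      by rewrite mem_candidates le_min le_max eqxx !orbT.
    move: le_min le_max; rewrite tau_min_le le_tau_max // => le_min le_max.
    have D0 : 0 < K * t - (N - 1) by move: K0; lra.
    have := exp_size_q_i1 t2 (lt0r_neq0 D0); set s' := exp_size _ _ => s'E.
    apply: red_max_min_g1A => //.
    - by rewrite s'E divr_gt0 // mulr_gt0 // (lt_trans _ t1).
    - by rewrite s'E mulrC divfK // lt0r_neq0.
  (* Below [tau_min] the right end [s = t], that is [q = 1], is optimal. *)
  rewrite tau_min_le -ltNge => /ltW gt_min; exists 1.
    by rewrite mem_candidates eqxx.
  by rewrite /exp_size mul1r subrK red_max_min_right.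
rewrite le_tau_max // -ltNge => gt_max.
have [/andP[s21 s2t] p2] := gt_tau_max_quad t2 gt_max.
(* [p(N / K) <= 0] makes [q_minus] real and places its root at or before [N / K]. *)
have re := q_minus_def t2 p2.
have /andP[sm1 _] := exp_size_q_minus_itv t2 re.
have := red_max_min_g1B N1 t1 K0 s0 (lt_le_trans ltr01 sm1)
  (exp_size_q_minus_le t2 re p2) (red_quad_q_minus t2 re) p2.
case/orP=> h.
  by exists (q_minus R n tau); rewrite // mem_candidates t2 re eqxx !orbT.
exists (q_i2 n mu L tau); last by rewrite exp_size_q_i2.
by rewrite mem_candidates ltNge le_tau_max // -ltNge gt_max tN eqxx !orbT.
Qed.

Lemma candidate_min_le (q : R) : q \in candidates n mu L tau ->
  candidate_min n mu L eps tau <= Omega n mu L eps q tau.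
Proof. by move=> qc; apply: bigmin_inf_seq qc _ (lexx _). Qed.

Lemma candidate_min_mem : exists2 q, q \in candidates n mu L tau &
  candidate_min n mu L eps tau = Omega n mu L eps q tau.
Proof.
rewrite /candidate_min big_seq.
elim/big_ind: _ => [|x y [q qc ->] [q' q'c ->]|q qc]; last by exists q.
  (* The default of the iterated minimum is the value at [1], the head of the list. *)
  by exists 1; rewrite ?mem_head.
by rewrite /Num.min; case: ifP => _; [exists q|exists q'].
Qed.

Lemma candidate_min_le_Omega (q : R) : 0 <= q <= 1 ->
  candidate_min n mu L eps tau <= Omega n mu L eps q tau.
Proof.
by case/candidate_le=> q' /candidate_min_le; exact: le_trans.
Qed.

End Candidates.

Theorem theorem3 (R : realType) (n : nat) (mu Lmax eps : R)
    (hn : (2 <= n)%N) (hmu : 0 < mu) (hmuL : mu <= Lmax)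
    (heps0 : 0 < eps) (heps1 : eps < 1) :
  (forall tau : nat, (1 <= tau <= n)%N ->
    exists2 q : R, q \in candidates n mu Lmax tau &
      minimizes `[0, 1] (fun q' : R => Omega n mu Lmax eps q' tau) q)
  /\
  (forall (taus : nat) (qs : R),
    minimizes [set tau : nat | (1 <= tau <= n)%N]
      (candidate_min n mu Lmax eps) taus ->
    qs \in candidates n mu Lmax taus ->
    Omega n mu Lmax eps qs taus = candidate_min n mu Lmax eps taus ->
    minimizes (`[0, 1] `*` [set tau : nat | (1 <= tau <= n)%N])
      (fun p : R * nat => Omega n mu Lmax eps p.1 p.2) (qs, taus)).
Proof.
split=> [tau tau_itv|taus qs [/= taus_itv taus_min] qsc qsE].
  have [q qc qE] := candidate_min_mem n tau mu Lmax eps.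
  exists q => //; split=> [|q' /=].
    by rewrite /= in_itv /=; exact: (candidates_itv hn hmu hmuL tau_itv qc).
  by rewrite in_itv /= -qE => q'01; exact: candidate_min_le_Omega.
split=> [|[q tau] [/=]].
  split=> //=; rewrite in_itv /=.
  exact: (candidates_itv hn hmu hmuL taus_itv qsc).
rewrite in_itv /= => q01 tau_itv; rewrite qsE.
by apply: le_trans (taus_min _ tau_itv) _; exact: candidate_min_le_Omega.
Qed.
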